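(* A $T_0$ space is $\mathbb{D}$-generated, where $\mathbb{D}$ is the collection of all one-point convergence spaces, if and only if it is monotone determined. Moreover, the category $\mathbf{Top_{md}}$ is a convenient Cartesian closed subcategory of the category of ($T_0$) topological spaces: it is Cartesian closed, and it equals $\mathbf{Top}_{\mathbb C}$ for some productive class $\mathbb C$ of $T_0$ spaces containing a non-empty space.
   Context: All spaces are $T_0$; $\mathbf{Top}$ is the category of $T_0$ spaces and continuous maps. The specialization order of a space $X$ is $x\sqsubseteq y$ iff $x\in\overline{\{y\}}$. Directed sets are non-empty. A directed subset $D$ of $X$ (directed in the specialization order), viewed as a net indexed by itself, converges to $x$ ($D\to x$) if it is eventually in every open neighbourhood of $x$. Monotone determined spaces: a space $X$ is monotone determined if a subset $U\subseteq X$ is open whenever for every directed subset $D$ of $X$ and every $x\in U$ with $D\to x$ in $X$, the net $D$ is eventually in $U$. $\mathbf{Top_{md}}$ is the category of monotone determined spaces and continuous maps. Generated spaces: let $\mathbb C$ be a class of $T_0$ spaces. A subset $U$ of a space $X$ is $\mathbb C$-open if $k^{-1}(U)$ is open in $C$ for every $C\in\mathbb C$ and every continuous map $k:C\to X$. $X$ is $\mathbb C$-generated if every $\mathbb C$-open subset is open. $\mathbf{Top}_{\mathbb C}$ is the full subcategory of $\mathbf{Top}$ of $\mathbb C$-generated spaces. A space $X$ is core compact if for every open $V$ and $x\in V$ there is an open $U$ with $x\in U\ll V$, where $U\ll V$ means that every open cover of $V$ has a finite subfamily covering $U$. $\mathbb C$ is productive if every space in $\mathbb C$ is core compact and every topological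 product $C_1\times C_2$ with $C_1,C_2\in\mathbb C$ is $\mathbb C$-generated. One-point convergence spaces: for a directed poset $D$ and an element $\infty\notin D$, let $\beta_D$ be the topology on $D\cup\{\infty\}$ having as a subbase all sets $\uparrow x$ and $\uparrow x\cup\{\infty\}$, $x\in D$, where $\uparrow x=\{y\in D: x\le y\}$. The spaces $(D\cup\{\infty\},\beta_D)$ are the one-point convergence spaces. *)

(* Defs.v *)
(* A [topologicalType] may be empty; the T0 axiom is the separate predicate
   [kolmogorov_space]. *)
From HB Require Import structures.
From mathcomp Require Import all_boot all_order.
From mathcomp Require Import all_classical.
From mathcomp Require Import topology.

Set Implicit Arguments.
Unset Strict Implicit.
Unset Printing Implicit Defensive.

Local Open Scope classical_set_scope.

Definition directed (T : Type) (r : T -> T -> Prop) (A : set T) : Prop :=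
  A !=set0 /\
  forall x y, A x -> A y -> exists z, [/\ A z, r x z & r y z].

Section MonotoneDetermined.
Context {X : topologicalType}.
Implicit Types (x y : X) (D U : set X).

Definition specialization x y : Prop := closure [set y] x.

(* [tails D U] says that the net D, indexed by itself, is eventually in U;
   hence [tails D --> x] is the convergence of that net to x. *)
Definition tails D : set_system X :=
  filter_from D (fun d => [set e | D e /\ specialization d e]).

End MonotoneDetermined.

Definition monotone_determined (X : topologicalType) : Prop :=
  forall U : set X,
    (forall (D : set X) (x : X),
       directed specialization D -> U x -> tails D --> x -> tails D U) ->
    open U.

Section Generated.
Variable C : topologicalType -> Prop.

Definition class_open (X : topologicalType) (U : set X) : Prop :=
  forall K : topologicalType, C K ->
  forall k : K -> X, continuous k -> open (k @^-1` U).

Definition class_generated (X : topologicalType) : Prop :=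
  forall U : set X, class_open U -> open U.

End Generated.

Definition way_below (X : topologicalType) (U V : set X) : Prop :=
  forall F : set_system X,
    (forall W, F W -> open W) -> V `<=` \bigcup_(W in F) W ->
    exists G : set_system X,
      [/\ finite_set G, G `<=` F & U `<=` \bigcup_(W in G) W].

Definition core_compact (X : topologicalType) : Prop :=
  forall (V : set X) (x : X), open V -> V x ->
  exists U : set X, [/\ open U, U x & way_below U V].

Definition productive (C : topologicalType -> Prop) : Prop :=
  (forall K : topologicalType, C K -> core_compact K) /\
  (forall K L : topologicalType, C K -> C L ->
     class_generated C (K * L)%type).

(* The added point is [None]; the points of D are the [Some x]. *)
Definition one_point_space {d : Order.disp_t} (D : porderType d) : Type :=
  option D.

Section OnePointSpace.
Context {d : Order.disp_t} (D : porderType d).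

Definition upset (x : D) : set (option D) :=
  [set Some y | y in [set y : D | (x <= y)%O]].

Definition beta_subbase : set_system (option D) :=
  [set A | exists x : D, A = upset x \/ A = upset x `|` [set None]].

HB.instance Definition _ := Choice.on (one_point_space D).
HB.instance Definition _ :=
  isSubBaseTopological.Build (one_point_space D) beta_subbase id.

End OnePointSpace.

Definition one_point_convergence_space (X : topologicalType) : Prop :=
  exists (d : Order.disp_t) (D : porderType d),
    directed (fun x y : D => (x <= y)%O) [set: D] /\
    X = (one_point_space D : topologicalType).

Record category := Category {
  obj : Type;
  hom : obj -> obj -> Type;
  idm : forall A, hom A A;
  comp : forall A B C, hom B C -> hom A B -> hom A C;
  comp_idl : forall A B (f : hom A B), comp (idm B) f = f;
  comp_idr : forall A B (f : hom A B), comp f (idm A) = f;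
  compA : forall A B C D (h : hom C D) (g : hom B C) (f : hom A B),
    comp h (comp g f) = comp (comp h g) f
}.

Section CartesianClosed.
Variable K : category.
Implicit Types A B E P Q T : obj K.

Definition is_terminal T : Prop := forall A, exists! f : hom A T, True.

Definition is_product A B P (p : hom P A) (q : hom P B) : Prop :=
  forall Q (f : hom Q A) (g : hom Q B),
  exists! h : hom Q P, comp p h = f /\ comp q h = g.

(* E, with the product (P, p, q) of E and A and the evaluation ev, is an
   exponential of B by A: every f : Q -> B out of a product Q of Z and A is
   ev o (g x id) for a unique g : Z -> E; h below is the arrow g x id. *)
Definition is_exponential A B E P (p : hom P E) (q : hom P A) (ev : hom P B)
    : Prop :=
  is_product p q /\
  forall (Z Q : obj K) (r : hom Q Z) (s : hom Q A) (f : hom Q B),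
    is_product r s ->
    exists! g : hom Z E, exists h : hom Q P,
      [/\ comp p h = comp g r, comp q h = s & comp ev h = f].

Definition cartesian_closed : Prop :=
  [/\ exists T, is_terminal T,
      forall A B, exists P (p : hom P A) (q : hom P B), is_product p q
    & forall A B, exists E P (p : hom P E) (q : hom P A) (ev : hom P B),
        is_exponential p q ev].

End CartesianClosed.

Section FullSubcategory.
Variable S : topologicalType -> Prop.

Definition space_in : Type := {X : topologicalType | S X}.

Definition space_map (A B : space_in) : Type :=
  continuousType (sval A : topologicalType) (sval B : topologicalType).

Definition space_id (A : space_in) : space_map A A := idfun.

Definition space_comp (A B C : space_in) (g : space_map B C)
  (f : space_map A B) : space_map A C := g \o f.

Lemma space_idl (A B : space_in) (f : space_map A B) :
  space_comp (space_id B) f = f.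
Proof. exact/continuousEP. Qed.

Lemma space_idr (A B : space_in) (f : space_map A B) :
  space_comp f (space_id A) = f.
Proof. exact/continuousEP. Qed.

Lemma space_compA (A B C D : space_in) (h : space_map C D)
    (g : space_map B C) (f : space_map A B) :
  space_comp h (space_comp g f) = space_comp (space_comp h g) f.
Proof. exact/continuousEP. Qed.

Definition full_subcategory : category :=
  Category space_idl space_idr space_compA.

End FullSubcategory.

(* Full subcategories of spaces are given by their classes of objects, so two
   of them are equal when these classes agree. *)
Definition Top_md (X : topologicalType) : Prop :=
  kolmogorov_space X /\ monotone_determined X.

Definition Top_gen (C : topologicalType -> Prop) (X : topologicalType) : Prop :=
  kolmogorov_space X /\ class_generated C X.

(* Main.v *)
Require Import Defs.
From HB Require Import structures.
From mathcomp Require Import all_boot all_order finmap.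
From mathcomp Require Import all_classical.
From mathcomp Require Import topology.

Set Implicit Arguments.
Unset Strict Implicit.
Unset Printing Implicit Defensive.

Import Order.TTheory.

Local Open Scope classical_set_scope.

(** Write x <= y for the specialization order. Call a set monotone open when
    it contains a tail of every directed set converging to one of its points,
    so that a space is monotone determined exactly when its monotone open sets
    are open. Monotone open sets form a topology, they are upper sets, and
    they are stable under preimages by continuous maps
    ([monotone_open_preimage]).

    Generation. One-point convergence spaces are monotone determined, since
    their added point is the limit of the directed poset they come from
    ([one_point_monotone_determined]); by stability under preimages, so is
    every space that they generate. Conversely a directed set D converging to
    x in a T0 space X is a poset, and the inclusion of D together with the
    value x at the added point is a continuous map from a one-point
    convergence space to X; openness of the preimage of U along it says that D
    is eventually in U ([monotone_determined_class_generated]).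

    Productivity. One-point convergence spaces are core compact, and their
    product with a monotone determined core compact space is monotone
    determined ([one_point_prod_monotone_determined]): core compactness of the
    second factor makes a choice of indices uniform on a neighbourhood.

    Cartesian closedness. The monotone open sets of a space X form a finer
    topology with the same specialization order and the same convergent
    directed sets. The resulting space, [md_coreflection X], is monotone
    determined, and a continuous map into X from a monotone determined space
    is also continuous into [md_coreflection X]. Hence categorical products
    are coreflections of topological products, and the exponential is the
    coreflection of the space of continuous maps with the pointwise topology:
    evaluation is continuous because it respects limits of directed sets
    ([evaluation_monotone_open]), and currying is continuous because
    continuity into a pointwise topology is checked one argument at a time. *)

(** * Directed sets and the specialization order *)

Lemma directed_finite_bound (T : Type) (I : eqType) (r : T -> T -> Prop)
    (A : set T) (P : I -> T -> Prop) (G : set I) :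
  directed r A ->
  (forall i x y, r x y -> P i x -> P i y) ->
  finite_set G -> (forall i, G i -> exists2 x, A x & P i x) ->
  exists2 x, A x & forall i, G i -> P i x.
Proof.
move=> [[x0 Ax0] dA] Pr /finite_seqP[s ->].
elim: s => [_|i s IHs sP]; first by exists x0.
have [|x Ax xs] := IHs; first by move=> j js; apply: sP; rewrite /= inE js orbT.
have [|y Ay yi] := sP i; first by rewrite /= mem_head.
have [z [Az xz yz]] := dA _ _ Ax Ay; exists z => // j.
by rewrite /= inE => /predU1P[->|/xs]; [exact: Pr yz _|exact: Pr xz].
Qed.

Section Specialization.
Context {X : topologicalType}.
Implicit Types (x y z : X) (U : set X).

Lemma specializationP x y :
  specialization x y <-> (forall U, open U -> U x -> U y).
Proof.
split=> [xy U oU Ux|xy U].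
  by have [_ [-> Uy]] := xy U (open_nbhs_nbhs (conj oU Ux)).
rewrite nbhsE => -[V [oV Vx] VU]; exists y; split=> //.
exact/VU/(xy V).
Qed.

Lemma specialization_refl x : specialization x x.
Proof. exact: subset_closure. Qed.

Lemma specialization_trans x y z :
  specialization x y -> specialization y z -> specialization x z.
Proof.
move=> /specializationP xy /specializationP yz; apply/specializationP => U oU.
by move=> /(xy _ oU) /(yz _ oU).
Qed.

(** In this form the T0 axiom passes to finer topologies with the same order,
    to products and to spaces of functions. *)
Lemma kolmogorov_antisym : kolmogorov_space X <->
  (forall x y, specialization x y -> specialization y x -> x = y).
Proof.
split=> [T0 x y xy yx|anti x y].
  apply/eqP/negP => /negP /T0[A [|]] [/set_mem Ax /set_mem /= Ay].
    by case: (xy _ Ax) => _ [-> /Ay].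
  by case: (yx _ Ax) => _ [-> /Ay].
move=> /eqP; apply: contra_notP => noA.
apply: anti => B Bx; apply: contrapT => nB; apply: noA; exists B.
  left; split; apply/mem_set => //= By; apply: nB.
  by exists y; split.
right; split; apply/mem_set => //= By; apply: nB.
by exists x; split.
Qed.

Lemma tails_cvg_meets (D : set X) x U :
  tails D --> x -> open U -> U x -> exists2 d, D d & U d.
Proof.
move=> Dx oU Ux; have [d Dd dU] := Dx U (open_nbhs_nbhs (conj oU Ux)).
by exists d => //; apply: dU; split=> //; exact: specialization_refl.
Qed.

End Specialization.

Lemma specialization_continuous (X Y : topologicalType) (f : X -> Y) (x y : X) :
  continuous f -> specialization x y -> specialization (f x) (f y).
Proof.
move=> /continuousP fc /specializationP xy; apply/specializationP => U oU.
exact: xy (fc _ oU).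
Qed.

Lemma continuous_id (X : topologicalType) : continuous (fun x : X => x).
Proof. by move=> x; exact: cvg_id. Qed.

Lemma continuous_compose (X Y Z : topologicalType) (f : X -> Y) (g : Y -> Z) :
  continuous f -> continuous g -> continuous (fun x => g (f x)).
Proof. by move=> fc gc x; exact: continuous_comp (fc x) (gc (f x)). Qed.

Lemma continuous_pair (Z X Y : topologicalType) (f : Z -> X) (g : Z -> Y) :
  continuous f -> continuous g -> continuous (fun z => (f z, g z)).
Proof. by move=> fc gc z; exact: (cvg_pair (fc z) (gc z)). Qed.

Lemma fst_continuous (X Y : topologicalType) :
  continuous (fst : X * Y -> X).
Proof. by move=> p; exact: cvg_fst. Qed.

Lemma snd_continuous (X Y : topologicalType) :
  continuous (snd : X * Y -> Y).
Proof. by move=> p; exact: cvg_snd. Qed.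

Lemma open_fst_preimage (X Y : topologicalType) (U : set X) :
  open U -> open [set p : X * Y | U p.1].
Proof. by have /continuousP := @fst_continuous X Y; apply. Qed.

Lemma open_snd_preimage (X Y : topologicalType) (U : set Y) :
  open U -> open [set p : X * Y | U p.2].
Proof. by have /continuousP := @snd_continuous X Y; apply. Qed.

(** * Monotone open sets *)

Definition monotone_open (X : topologicalType) (U : set X) : Prop :=
  forall (D : set X) (x : X),
    directed specialization D -> U x -> tails D --> x -> tails D U.

Section MonotoneOpen.
Context {X : topologicalType}.
Implicit Types (x y : X) (D U V : set X).

Lemma open_monotone_open U : open U -> monotone_open U.
Proof. by move=> oU D x _ Ux; apply; exact: open_nbhs_nbhs. Qed.

(** Monotone nets indexed by an arbitrary directed preorder: the range of such
    a net is a directed subset with the same limits, and a tail of the range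
    contains a tail of the net. *)
Lemma monotone_open_net (I : Type) (r : I -> I -> Prop) (A : set I)
    (f : I -> X) x U :
  directed r A -> (forall i j, r i j -> specialization (f i) (f j)) ->
  (forall V, open V -> V x -> exists2 i, A i & V (f i)) ->
  monotone_open U -> U x ->
  exists2 i, A i & forall j, A j -> r i j -> U (f j).
Proof.
move=> [[i0 Ai0] dA] fr fx mU Ux.
have dfA : directed specialization (f @` A).
  split; first by exists (f i0), i0.
  move=> _ _ [i Ai <-] [j Aj <-]; have [k [Ak ik jk]] := dA _ _ Ai Aj.
  by exists (f k); split; [exists k|exact: fr|exact: fr].
have [|_ [i Ai <-] iU] := mU _ _ dfA Ux.
  move=> W; rewrite nbhsE => -[V [oV Vx] VW].
  have [i Ai Vi] := fx V oV Vx; exists (f i); first by exists i.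
  move=> y [_ /specializationP iy]; exact/VW/(iy V).
by exists i => // j Aj ij; apply: iU; split; [exists j|exact: fr].
Qed.

(** When x <= y, the constant net y converges to x. *)
Lemma monotone_open_upper U x y :
  monotone_open U -> specialization x y -> U x -> U y.
Proof.
move=> mU /specializationP xy Ux.
have dT : directed (fun _ _ : unit => True) setT.
  by split; [exists tt|move=> *; exists tt].
have [||[] _ /(_ tt)] := monotone_open_net (f := fun=> y) (x := x) dT _ _ mU Ux.
- by move=> *; exact: specialization_refl.
- by move=> V oV Vx; exists tt => //; exact: (xy V).
- exact.
Qed.

Lemma monotone_openI U V :
  monotone_open U -> monotone_open V -> monotone_open (U `&` V).
Proof.
move=> mU mV D x dD [Ux Vx] Dx.
have [d Dd dU] := mU _ _ dD Ux Dx; have [e De eV] := mV _ _ dD Vx Dx.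
have [g [Dg dg eg]] := dD.2 _ _ Dd De.
exists g => // h [Dh gh]; split; [apply: dU|apply: eV]; split=> //;
exact: specialization_trans gh.
Qed.

Lemma monotone_open_bigcup (I : Type) (f : I -> set X) :
  (forall i, monotone_open (f i)) -> monotone_open (\bigcup_i f i).
Proof.
move=> mf D x dD [i _ fx] Dx; have [d Dd df] := mf i _ _ dD fx Dx.
by exists d => // e /df fe; exists i.
Qed.

End MonotoneOpen.

Lemma monotone_open_preimage (X Y : topologicalType) (f : X -> Y) (U : set Y) :
  continuous f -> monotone_open U -> monotone_open (f @^-1` U).
Proof.
move=> fc mU D x dD Ux Dx.
have [||d Dd dU] := monotone_open_net (f := f) dD _ _ mU Ux.
- by move=> *; exact: specialization_continuous.
- by move=> V oV; apply: (tails_cvg_meets Dx); move/continuousP: fc; apply.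
- by exists d => // e [De de]; exact: dU.
Qed.

(** Monotone open sets pull back to open sets along every continuous map from
    a monotone determined space, hence they are open for the class. *)
Lemma class_generated_monotone_determined (C : topologicalType -> Prop)
    (X : topologicalType) :
  (forall K, C K -> monotone_determined K) ->
  class_generated C X -> monotone_determined X.
Proof.
move=> Cmd XC U mU; apply: XC => K CK k kc.
exact/(Cmd K CK)/monotone_open_preimage.
Qed.

(** * One-point convergence spaces *)

Section OnePoint.
Context {d : Order.disp_t} {D : porderType d}.
Hypothesis dirD : directed (fun x y : D => (x <= y)%O) [set: D].
Notation K := (one_point_space D).
Implicit Types (U V : set K) (x y : D).

(** Directedness of D bounds the finitely many subbasic sets that meet in a
    basic neighbourhood of the added point, so those neighbourhoods are
    generated by the sets consisting of an upset and the added point. *)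
Lemma one_point_openP U : open U <->
  (forall x y, (x <= y)%O -> U (Some x) -> U (Some y)) /\
  (U None -> exists x, forall y, (x <= y)%O -> U (Some y)).
Proof.
split.
  move=> [F sF <-].
  have finI_bound B : finI_from (@beta_subbase _ D) id B -> B None ->
    exists x, forall y, (x <= y)%O -> B (Some y).
    move=> [G sG <-] GN.
    have [|||x _ xG] := @directed_finite_bound _ (set (option D)) _ _
       (fun A x => forall y, (x <= y)%O -> A (Some y)) [set` G] dirD.
    - by move=> A x y xy xA z yz; apply/xA/(le_trans xy).
    - exact: finite_fset.
    - move=> A /[dup] GA /sG /set_mem[x [|] Ax].
        by have := GN A GA; rewrite /= Ax => -[].
      by exists x => // y xy; rewrite Ax; left; exists y.
    by exists x => y xy A GA; exact: xG.
  split=> [x y xy [B FB Bx]|[B FB BN]].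
    exists B => //; have [G sG GB] := sF _ FB; move: Bx; rewrite -GB => GBx.
    move=> A /[dup] GA /sG /set_mem[z [|] Az]; have := GBx A GA; rewrite /= Az.
      move=> [t /= zt [tx]]; exists y => //=.
      by apply: le_trans zt _; rewrite tx.
    move=> [[t /= zt [tx]]|//]; left; exists y => //=.
    by apply: le_trans zt _; rewrite tx.
  have [x xB] := finI_bound B (sF B FB) BN.
  by exists x => y /xB; exists B.
move=> [upU UN].
exists [set A | beta_subbase A /\ A `<=` U].
  by move=> A [bA _]; exact: (finI_from1 id).
rewrite predeqE => -[x|]; split=> [[A [_ AU] /AU//]|].
- move=> Ux; exists (upset x); last by exists x => //=.
  split; first by exists x; left.
  by move=> _ [y xy <-]; exact: upU Ux.
- move=> UN'; have [x xU] := UN UN'.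
  exists (upset x `|` [set None]); last by right.
  split; first by exists x; right.
  by move=> _ [[y xy <-]|->]; [exact: xU|].
Qed.

Lemma one_point_open_upset x (A : set K) :
  A `<=` [set None] -> open (upset x `|` A : set K).
Proof.
move=> AN; apply/one_point_openP; split=> [y z yz|_].
  move=> [[t /= xt [ty]]|/AN//]; left; exists z => //=.
  by apply: le_trans xt _; rewrite ty.
by exists x => y xy; left; exists y.
Qed.

Lemma one_point_specialization x y : (x <= y)%O ->
  specialization (Some x : K) (Some y : K).
Proof.
move=> xy; apply/specializationP => U /one_point_openP[upU _]; exact: upU.
Qed.

Lemma one_point_cvg U : open U -> U None -> exists x, U (Some x).
Proof. by move=> /one_point_openP[_ UN] /UN[x xU]; exists x; exact: xU. Qed.

Lemma one_point_kolmogorov : kolmogorov_space K.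
Proof.
have ox x : open (upset x : set K).
  by rewrite -[upset x]setU0; exact: one_point_open_upset.
apply/kolmogorov_antisym.
have up x (p : K) : specialization (Some x : K) p -> upset x p.
  by move=> /specializationP/(_ _ (ox x)); apply; exists x => /=.
move=> [x|] [y|] // /[dup].
- move=> _ /up [z /= xz [zy]] /up[t /= yt [tx]]; congr Some.
  by apply: le_anti; rewrite -{1}zy xz -tx yt.
- by move=> _ /up[].
- by move=> _ _ /up[].
Qed.

Lemma one_point_monotone_determined : monotone_determined K.
Proof.
move=> U mU; apply/one_point_openP; split.
  by move=> x y /one_point_specialization; exact: monotone_open_upper.
move=> UN; have [||x _ xU] := monotone_open_net (f := Some : D -> K) dirD _ _
  (mU : monotone_open U) UN.
- exact: one_point_specialization.
- by move=> V oV VN; have [x Vx] := one_point_cvg oV VN; exists x.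
by exists x => y; exact: xU.
Qed.

(** An upset, with or without the added point, is way below any open set
    containing it: one member of a cover contains the least element of the
    upset, hence all of it, and one more contains the added point. *)
Lemma one_point_core_compact : core_compact K.
Proof.
move=> V p /[dup] oV /one_point_openP[upV VN] Vp.
have [x [Vx px]] : exists x, V (Some x) /\ (p = Some x \/ p = None).
  case: p Vp => [x Vx|/VN[x xV]]; first by exists x; split; [|left].
  by exists x; split; [exact: xV|right].
(* The intersection adds p to the upset only if p is the added point. *)
exists (upset x `|` [set None] `&` [set p]); split.
- by apply: one_point_open_upset => q [].
- by case: px => ->; [left; exists x => /=|right].
move=> F oF VF; have [A FA Ax] := VF _ Vx; have [B FB Bp] := VF _ Vp.
exists [set A; B]; split; first exact: finite_set2.
  by move=> _ [->|->].
move=> q [[y xy <-]|[_ ->]]; last by exists B => //; right.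
exists A; first by left.
by have /one_point_openP[upA _] := oF _ FA; exact: upA Ax.
Qed.

(** Let U be monotone open in K * L. Its fibers over the points of K are open,
    because L is monotone determined. The fibers over the points of D increase
    with the point, so near (x, l) with x in D the set U contains the product
    of the upset of x and the fiber over x. At (None, l), the fibers over D
    cover the fiber over None, since None is the limit of D. Choosing W with
    l in W way below that last fiber, finitely many fibers over D, hence by
    directedness a single one, cover W. *)
Lemma one_point_prod_monotone_determined (L : topologicalType) :
  monotone_determined L -> core_compact L -> monotone_determined (K * L)%type.
Proof.
move=> mdL ccL U mU.
have fiber_open k : open [set l | U (k, l)].
  have kc := continuous_pair (@cst_continuous L K k) (@continuous_id L).
  exact: mdL (monotone_open_preimage kc mU).
have row_continuous l :=
  continuous_pair (@continuous_id K) (@cst_continuous K L l).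
have upU x y l : (x <= y)%O -> U (Some x, l) -> U (Some y, l).
  move=> /one_point_specialization xy; apply: monotone_open_upper mU _.
  exact: specialization_continuous (row_continuous l) xy.
rewrite openE => -[[x|] l] Ul.
  exists (upset x `|` set0, [set l' | U (Some x, l')]); first split=> /=.
  - apply: open_nbhs_nbhs; split; first exact: one_point_open_upset.
    by left; exists x => /=.
  - by apply: open_nbhs_nbhs; split; [exact: fiber_open|].
  by move=> [_ m] /= [[[y /= xy <-]|//]]; exact: upU.
have [W [oW Wl WU]] := ccL _ l (fiber_open None) Ul.
have [||G [finG GF WG]] := WU (range (fun x => [set m | U (Some x, m)])).
- by move=> _ [x _ <-]; exact: fiber_open.
- move=> m /= Um.
  have [||x _ xU] := monotone_open_net (f := Some : D -> K) (x := None : K)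
    dirD _ _ (monotone_open_preimage (row_continuous m) mU) Um.
  + exact: one_point_specialization.
  + by move=> V oV VN; have [x Vx] := one_point_cvg oV VN; exists x.
  + by exists [set m' | U (Some x, m')]; [exists x|exact: xU].
have [||x _ xG] := directed_finite_bound
   (P := fun (A : set L) x => A `<=` [set m | U (Some x, m)]) dirD _ finG.
- by move=> A x y xy xA m /xA; exact: upU.
- by move=> _ /GF[x _ <-]; exists x.
exists (upset x `|` [set None], W `&` [set m | U (None, m)]); first split=> /=.
- by apply: open_nbhs_nbhs; split; [exact: one_point_open_upset|right].
- by apply: open_nbhs_nbhs; split; [exact: openI|].
move=> [_ m] /= [[[y /= xy <-]|->] [/WG[A GA Am] Um]] //.
exact: upU xy (xG A GA m Am).
Qed.

End OnePoint.

Section SpecializationPoset.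
Context {X : topologicalType}.

(** Antisymmetry of the order on D comes from the T0 axiom, whose proof is
    therefore a parameter of the type. *)
Definition specialization_poset (T0 : kolmogorov_space X) (D : set X) : Type :=
  set_type D.

Section Order.
Variables (T0 : kolmogorov_space X) (D : set X).
Notation P := (specialization_poset T0 D).

HB.instance Definition _ := Choice.on P.

Let le (x y : P) : bool := `[< specialization (val x) (val y) >].

Let le_refl : reflexive le.
Proof. by move=> x; apply/asboolP; exact: specialization_refl. Qed.

Let le_anti : antisymmetric le.
Proof.
move=> x y /andP[/asboolP xy /asboolP yx]; apply: val_inj.
exact: kolmogorov_antisym.1 T0 _ _ xy yx.
Qed.

Let le_trans : transitive le.
Proof.
move=> y x z /asboolP xy /asboolP yz; apply/asboolP.
exact: specialization_trans xy yz.
Qed.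

HB.instance Definition _ :=
  Order.Le_isPOrder.Build (Order.Disp tt tt) P le_refl le_anti le_trans.

Lemma specialization_posetE (x y : P) :
  (x <= y)%O <-> specialization (val x) (val y).
Proof. by split=> /asboolP. Qed.

Lemma specialization_poset_directed :
  directed specialization D ->
  directed (fun x y : P => (x <= y)%O) [set: P].
Proof.
move=> [[x Dx] dD]; split; first by exists (SigSub (mem_set Dx)).
move=> y z _ _.
have [w [Dw yw zw]] := dD _ _ (set_valP y) (set_valP z).
by exists (SigSub (mem_set Dw)); split=> //; exact/specialization_posetE.
Qed.

End Order.
End SpecializationPoset.

Lemma monotone_determined_class_generated (X : topologicalType) :
  kolmogorov_space X -> monotone_determined X ->
  class_generated one_point_convergence_space X.
Proof.
move=> T0 mdX U oU; apply: mdX => D x dD Ux Dx.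
have dP := specialization_poset_directed T0 dD.
pose k (p : one_point_space (specialization_poset T0 D)) :=
  if p is Some y then val y else x.
have kc : continuous k.
  apply/continuousP => V oV; apply/one_point_openP => //; split.
    by move=> y z /specialization_posetE/specializationP yz; exact: yz.
  move=> /= Vx; have [d Dd Vd] := tails_cvg_meets Dx oV Vx.
  exists (SigSub (mem_set Dd)) => y /specialization_posetE/specializationP dy.
  exact: dy.
have : open (k @^-1` U).
  by apply: oU kc; eexists; eexists; split; [exact: dP|].
move=> /(one_point_openP dP)[_ /(_ Ux)[d dU]].
exists (val d); first exact: set_valP.
move=> e [De de].
by apply: (dU (SigSub (mem_set De))); apply/specialization_posetE.
Qed.

Lemma kolmogorov_prod (X Y : topologicalType) :
  kolmogorov_space X -> kolmogorov_space Y -> kolmogorov_space (X * Y)%type.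
Proof.
move=> /kolmogorov_antisym aX /kolmogorov_antisym aY; apply/kolmogorov_antisym.
move=> p q pq qp; rewrite (surjective_pairing p) (surjective_pairing q).
have fst_mono := specialization_continuous (@fst_continuous X Y).
have snd_mono := specialization_continuous (@snd_continuous X Y).
congr (_, _).
  by apply: aX; exact: fst_mono.
by apply: aY; exact: snd_mono.
Qed.

Lemma one_point_productive : productive one_point_convergence_space.
Proof.
split=> [_ [d [D [dirD ->]]]|K L CK CL]; first exact: one_point_core_compact.
move: CK CL => [d [D [dirD ->]]] [e [E [dirE ->]]].
apply: monotone_determined_class_generated.
  by apply: kolmogorov_prod; exact: one_point_kolmogorov.
apply: one_point_prod_monotone_determined => //.
  exact: one_point_monotone_determined.
exact: one_point_core_compact.
Qed.

(** * The monotone determined coreflection *)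

Definition md_coreflection (X : topologicalType) : Type := X.

Section Coreflection.
Variable X : topologicalType.
Notation mdX := (md_coreflection X).

Let monotone_openT : monotone_open [set: X].
Proof. exact/open_monotone_open/openT. Qed.

HB.instance Definition _ := Choice.on mdX.
HB.instance Definition _ := isOpenTopological.Build mdX monotone_openT
  (@monotone_openI X) (@monotone_open_bigcup X).

Lemma md_coreflection_continuous : continuous (fun x : mdX => x : X).
Proof. by apply/continuousP => U; exact: open_monotone_open. Qed.

(** The topology of the coreflection is finer, but its open sets are still
    upper sets for the original order. *)
Lemma md_coreflection_specialization (x y : mdX) :
  specialization x y <-> @specialization X x y.
Proof.
split; first exact: specialization_continuous md_coreflection_continuous.
by move=> xy; apply/specializationP => U mU; exact: monotone_open_upper mU xy.
Qed.

Lemma md_coreflection_kolmogorov : kolmogorov_space X -> kolmogorov_space mdX.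
Proof.
move=> /kolmogorov_antisym aX; apply/kolmogorov_antisym => x y.
move=> /md_coreflection_specialization xy /md_coreflection_specialization.
exact: aX xy.
Qed.

Lemma md_coreflection_monotone_determined : monotone_determined mdX.
Proof.
move=> U mU; change (@monotone_open X U) => D x dD Ux Dx.
have [||d Dd dU] := monotone_open_net (f := fun x : X => x : mdX) dD _ _
  (mU : @monotone_open mdX U) Ux.
- by move=> y z /md_coreflection_specialization.
- move=> V mV Vx; have [d Dd dV] := mV D x dD Vx Dx.
  by exists d => //; apply: dV; split=> //; exact: specialization_refl.
- by exists d => // e [De de]; exact: dU.
Qed.

Lemma md_coreflection_lift (Z : topologicalType) (f : Z -> X) :
  monotone_determined Z -> continuous f -> continuous (f : Z -> mdX).
Proof.
move=> mdZ fc; apply/continuousP => U mU.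
exact: mdZ (monotone_open_preimage fc mU).
Qed.

End Coreflection.

(** * Spaces of continuous maps with the pointwise topology *)

Section FunctionSpace.
Variables X Y : topologicalType.

Definition pointwise_space : Type :=
  initial_topology (fun f : continuousType X Y => (f : {ptws X -> Y})).

HB.instance Definition _ := Topological.on pointwise_space.

Definition pointwise_apply (f : pointwise_space) : X -> Y :=
  (f : continuousType X Y).

Lemma pointwise_apply_continuousl (x : X) :
  continuous (fun f => pointwise_apply f x).
Proof.
move=> f; apply: (@continuous_comp pointwise_space {ptws X -> Y} Y
  (fun f : continuousType X Y => (f : {ptws X -> Y})) (fun g => g x)).
  exact: initial_continuous.
exact: (@proj_continuous X (fun=> Y) x).
Qed.

Lemma pointwise_apply_continuousr (f : pointwise_space) :
  continuous (pointwise_apply f).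
Proof. exact: (@cts_fun _ _ (f : continuousType X Y)). Qed.

Lemma pointwise_continuous (Z : topologicalType) (g : Z -> pointwise_space) :
  (forall x, continuous (fun z => pointwise_apply (g z) x)) -> continuous g.
Proof.
move=> gc; apply: continuous_comp_initial => z.
apply/cvg_sup => x U.
rewrite nbhsE => -[_ [[V oV <-] /= Vgz] VU].
apply: filterS VU _.
by apply: (gc x z); exact: open_nbhs_nbhs.
Qed.

Lemma pointwise_kolmogorov :
  kolmogorov_space Y -> kolmogorov_space pointwise_space.
Proof.
move=> /kolmogorov_antisym aY; apply/kolmogorov_antisym => f g fg gf.
apply/continuousEP => x; apply: aY.
  by have := specialization_continuous (@pointwise_apply_continuousl x) fg.
by have := specialization_continuous (@pointwise_apply_continuousl x) gf.
Qed.

(** Evaluation is in general not jointly continuous for the pointwise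
    topology, but it respects limits of directed sets: if D converges to
    (f, a) and f a lies in V, continuity of f puts some p in D with f p.2 in
    V, then continuity of evaluation at p.2 puts some q in D with q.1 p.2 in
    V, and every s in D above p and q satisfies s.1 s.2 >= q.1 p.2, since
    each s.1 is monotone and the order of functions is pointwise. *)
Lemma evaluation_monotone_open (V : set Y) : open V ->
  monotone_open [set p : pointwise_space * X | V (pointwise_apply p.1 p.2)].
Proof.
move=> oV D [f a] dD /= Vfa Dfa.
have open_row : open [set p : pointwise_space * X | V (pointwise_apply f p.2)].
  have /continuousP fc := @pointwise_apply_continuousr f.
  exact: (open_snd_preimage (fc V oV)).
have [p Dp Vp] := tails_cvg_meets Dfa open_row Vfa.
have open_column :
    open [set q : pointwise_space * X | V (pointwise_apply q.1 p.2)].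
  have /continuousP ac := @pointwise_apply_continuousl p.2.
  exact: (open_fst_preimage (ac V oV)).
have [q Dq Vq] := tails_cvg_meets Dfa open_column Vp.
have [r [Dr pr qr]] := dD.2 _ _ Dp Dq.
exists r => // s [Ds rs].
have ps := specialization_trans pr rs; have qs := specialization_trans qr rs.
have := specialization_continuous (@pointwise_apply_continuousr s.1)
  (specialization_continuous (@snd_continuous _ _) ps).
move=> /specializationP; apply => //.
have := specialization_continuous (@pointwise_apply_continuousl p.2)
  (specialization_continuous (@fst_continuous _ _) qs).
by move=> /specializationP; apply.
Qed.

End FunctionSpace.

(** * Cartesian closedness *)

Lemma product_iso (K : category) (A B P Q : obj K) (p : hom P A) (q : hom P B)
    (r : hom Q A) (s : hom Q B) :
  is_product p q -> is_product r s ->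
  exists (u : hom P Q) (v : hom Q P),
    [/\ Defs.comp r u = p, Defs.comp s u = q, Defs.comp p v = r,
        Defs.comp q v = s & Defs.comp u v = idm Q].
Proof.
move=> pqP rsP; have [u [[ru su] _]] := rsP _ p q.
have [v [[pv qv] _]] := pqP _ r s.
exists u, v; split=> //; have [w [_ wU]] := rsP _ r s.
rewrite -(wU (idm Q)); last by split; exact: comp_idr.
by rewrite -(wU (Defs.comp u v)) // !Defs.compA ru su.
Qed.

Lemma Top_md_unit : Top_md (discrete_topology unit).
Proof.
split=> [[] [] //|U _]; rewrite openE => x Ux.
by rewrite /interior nbhs_principalE; exact/principal_filterP.
Qed.

Section CartesianClosedness.
Notation space := (space_in Top_md).
Notation Cat := (full_subcategory Top_md).
Notation arrow := (@hom Cat).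
(* The value of an arrow, which has to be seen as a continuous map first. *)
Notation app f x := ((f : space_map _ _) x).
Implicit Types A B Z Q : space.

Definition md_arrow A B (f : sval A -> sval B) (fc : continuous f) :
  arrow A B := mkcts fc.

Lemma md_arrow_continuous A B (f : arrow A B) : continuous (f : space_map A B).
Proof. exact: cts_fun. Qed.

Lemma md_arrow_ext A B (f g : arrow A B) :
  (forall x, app f x = app g x) -> f = g.
Proof. by move=> fg; exact/continuousEP. Qed.

Lemma md_arrow_app A B (f g : arrow A B) :
  f = g -> forall x, app f x = app g x.
Proof. by move=> ->. Qed.

Definition md_space (X : topologicalType) (T0 : kolmogorov_space X) : space :=
  exist _ (md_coreflection X : topologicalType)
    (conj (md_coreflection_kolmogorov T0)
       (@md_coreflection_monotone_determined X)).

Definition md_point : space :=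
  exist _ (discrete_topology unit : topologicalType) Top_md_unit.

(** The topological product need not be monotone determined; its coreflection
    is the product of the category, because maps into it out of monotone
    determined spaces are the maps into the topological product. *)
Definition md_prod A B : space :=
  md_space (kolmogorov_prod (svalP A).1 (svalP B).1).

Lemma md_fst_continuous A B :
  continuous (fst : sval (md_prod A B) -> sval A).
Proof.
exact: continuous_compose (@md_coreflection_continuous _) (@fst_continuous _ _).
Qed.

Lemma md_snd_continuous A B :
  continuous (snd : sval (md_prod A B) -> sval B).
Proof.
exact: continuous_compose (@md_coreflection_continuous _) (@snd_continuous _ _).
Qed.

Lemma md_pair_continuous Z A B (f : sval Z -> sval A) (g : sval Z -> sval B) :
  continuous f -> continuous g ->
  continuous ((fun z => (f z, g z)) : sval Z -> sval (md_prod A B)).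
Proof.
move=> fc gc.
exact: md_coreflection_lift (svalP Z).2 (continuous_pair fc gc).
Qed.

Definition md_fst A B := md_arrow (@md_fst_continuous A B).
Definition md_snd A B := md_arrow (@md_snd_continuous A B).

Lemma md_pairE A B Q (h : arrow Q (md_prod A B)) (f : arrow Q A)
    (g : arrow Q B) :
  Defs.comp (md_fst A B) h = f -> Defs.comp (md_snd A B) h = g ->
  forall w, app h w = (app f w, app g w).
Proof. by move=> <- <- w; exact: surjective_pairing. Qed.

Lemma md_prod_is_product A B : is_product (md_fst A B) (md_snd A B).
Proof.
move=> Q f g.
have fgc := md_pair_continuous (@md_arrow_continuous _ _ f)
  (@md_arrow_continuous _ _ g).
exists (md_arrow fgc); split; first by split; exact: md_arrow_ext.
by move=> h [hf hg]; apply: md_arrow_ext => w; rewrite (md_pairE hf hg w).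
Qed.

Definition md_exp A B : space :=
  md_space (@pointwise_kolmogorov (sval A) (sval B) (svalP B).1).

Definition md_eval_fun A B (p : sval (md_prod (md_exp A B) A)) : sval B :=
  pointwise_apply p.1 p.2.

Lemma md_eval_continuous A B : continuous (@md_eval_fun A B).
Proof.
apply/continuousP => V oV.
pose E : topologicalType := pointwise_space (sval A) (sval B).
pose mdE : topologicalType := md_coreflection E.
have Ec : continuous (fun p : mdE * sval A => p.1 : E).
  exact: (@continuous_compose _ mdE E fst id (@fst_continuous mdE (sval A))
    (@md_coreflection_continuous E)).
have fc := continuous_pair Ec (@snd_continuous mdE (sval A)).
exact: (monotone_open_preimage fc (evaluation_monotone_open oV)).
Qed.

Definition md_eval A B := md_arrow (@md_eval_continuous A B).

Section Curry.
Variables (Z A B : space) (f : arrow (md_prod Z A) B).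

Lemma md_row_continuous (z : sval Z) :
  continuous ((fun a => app f (z, a)) : sval A -> sval B).
Proof.
exact: continuous_compose
  (md_pair_continuous (@cst_continuous _ _ z) (@continuous_id _))
  (@md_arrow_continuous _ _ f).
Qed.

Lemma md_column_continuous (a : sval A) :
  continuous ((fun z => app f (z, a)) : sval Z -> sval B).
Proof.
exact: continuous_compose
  (md_pair_continuous (@continuous_id _) (@cst_continuous _ _ a))
  (@md_arrow_continuous _ _ f).
Qed.

Lemma md_curry_continuous :
  continuous ((fun z => mkcts (@md_row_continuous z)) :
    sval Z -> sval (md_exp A B)).
Proof.
apply: md_coreflection_lift (svalP Z).2 _.
by apply: pointwise_continuous => a; exact: md_column_continuous.
Qed.

Definition md_curry : arrow Z (md_exp A B) := md_arrow md_curry_continuous.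

End Curry.

(** An arbitrary product Q of Z and A is isomorphic to md_prod Z A, so that an
    arrow out of Q can be curried after transport along u : md_prod Z A -> Q;
    everything then reduces to equations between values at points. *)
Lemma md_exp_is_exponential A B :
  is_exponential (md_fst (md_exp A B) A) (md_snd (md_exp A B) A) (md_eval A B).
Proof.
split=> [|Z Q r s f rsP]; first exact: md_prod_is_product.
have [u [v [ru su pv qv uv]]] := product_iso (@md_prod_is_product Z A) rsP.
exists (md_curry (Defs.comp f u)); split.
  have [h [[ph qh] _]] :=
    md_prod_is_product (Defs.comp (md_curry (Defs.comp f u)) r) s.
  exists h; split=> //.
  rewrite -(comp_idr f) -uv Defs.compA; apply: md_arrow_ext => w.
  change (md_eval_fun (app h w) = app f (app u (app v w))).
  by rewrite (md_pairE ph qh w) (md_pairE pv qv w).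
move=> g [h [ph qh eh]].
apply: md_arrow_ext => z; apply/continuousEP => a.
pose w : sval Q := app u (z, a).
have rw : app r w = z := md_arrow_app ru (z, a).
have sw : app s w = a := md_arrow_app su (z, a).
change (app f w = pointwise_apply (app g z) a).
have <- : md_eval_fun (app h w) = app f w := md_arrow_app eh w.
rewrite (md_pairE ph qh w).
change (pointwise_apply (app g (app r w)) (app s w) =
  pointwise_apply (app g z) a).
by rewrite rw sw.
Qed.

Lemma Top_md_cartesian_closed : cartesian_closed Cat.
Proof.
split=> [|A B|A B].
- exists md_point => A.
  exists (md_arrow (@cst_continuous (sval A) (sval md_point) tt)).
  split=> // f _; apply: md_arrow_ext => x.
  by case: (RHS).
- exists (md_prod A B), (md_fst A B), (md_snd A B).
  exact: md_prod_is_product.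
- exists (md_exp A B), (md_prod (md_exp A B) A), (md_fst _ _), (md_snd _ _).
  by exists (md_eval A B); exact: md_exp_is_exponential.
Qed.

End CartesianClosedness.

Theorem theorem14 :
  (forall X : topologicalType, kolmogorov_space X ->
     (class_generated one_point_convergence_space X <-> monotone_determined X))
  /\
  (cartesian_closed (full_subcategory Top_md) /\
   exists C : topologicalType -> Prop,
     [/\ forall K : topologicalType, C K -> kolmogorov_space K,
         productive C,
         exists K : topologicalType, C K /\ [set: K] !=set0
       & forall X : topologicalType, Top_md X <-> Top_gen C X]).
Proof.
have generatedP X : kolmogorov_space X ->
    class_generated one_point_convergence_space X <-> monotone_determined X.
  move=> T0; split; last exact: monotone_determined_class_generated.
  apply: class_generated_monotone_determined => _ [d [D [dirD ->]]].
  exact: one_point_monotone_determined.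
split; first exact: generatedP.
split; first exact: Top_md_cartesian_closed.
exists one_point_convergence_space; split.
- by move=> _ [d [D [dirD ->]]]; exact: one_point_kolmogorov.
- exact: one_point_productive.
- exists (one_point_space nat); split; last by exists None.
  eexists; eexists; split; last by [].
  split; first by exists 0%N.
  move=> m n _ _; exists (maxn m n).
  by split=> //; [exact: leq_maxl|exact: leq_maxr].
- by move=> X; split=> -[T0 XP]; split=> //; apply/generatedP.
Qed.
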